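(* Let $n,r$ be positive integers. For all integers $1\le \ell \le n$ and $0\le c \le r-1$, the following identity of formal power series in $x$ holds: $$\frac{ G^{\ell, c}_{n,r}(x,q)}{(xq^r;q^r)_{n}} = \delta_{\ell,1}\delta_{c,0} + \sum_{i=1}^{\infty} \left( [r i-c]_{q}^{\ell-1}\, [r i-c+1]_{q}^{n-\ell}\, q^{ri-c}\right) x^i.$$
   Context: Notation: $x,q$ are indeterminates; $[i]_q=1+q+\cdots+q^{i-1}$; $(x;q)_{n}=\prod_{i=0}^{n-1}(1-xq^i)$ with $(x;q)_0=1$, so that $(xq^r;q^r)_n=\prod_{i=1}^{n}(1-xq^{ri})$; $\delta$ is the Kronecker delta; $[n]=\{1,\ldots,n\}$ and $\mathfrak{S}_n$ is the set of permutations of $[n]$. The elements of the wreath product $\mathbb{Z}_r \wr \mathfrak{S}_n$ are viewed as $r$-colored permutations, written $\pi = (\pi(1)_{\xi_1}, \ldots, \pi(n)_{\xi_n})$, where $(\pi(1), \ldots, \pi(n) ) \in \mathfrak{S}_n$ and $(\xi_1, \ldots, \xi_n) \in \{0,1,\ldots,r-1\}^n$. An index $i\in[n]$ is a descent position of $\pi$ if $\xi_i > \xi_{i+1}$, or $\xi_i = \xi_{i+1}$ and $\pi(i) > \pi(i+1)$, with the convention $\pi(n+1)=n+1$, $\xi_{n+1}=0$. The descent number $\mathrm{des}(\pi)$ is the number of descent positions, the major index $\mathrm{maj}(\pi)$ is the sum of the descent positions, and the flag major index is $$\mathrm{fmaj}(\pi) = r \cdot \mathrm{maj}(\pi)-\sum_{i=1}^{n}\xi_{i}.$$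 For $1\le \ell \le n$ and $0\le c \le r-1$, $$G^{\ell, c}_{n,r}(x,q) = \sum_{\pi \in \mathbb{Z}_r \wr \mathfrak{S}_n,\ \pi(1) = \ell,\ \xi_1= c} x^{\mathrm{des}(\pi)}q^{\mathrm{fmaj}(\pi)}.$$ *)

(* Defs.v *)
From HB Require Import structures.
From mathcomp Require Import all_boot all_order all_algebra all_fingroup.

Set Implicit Arguments.
Unset Strict Implicit.
Unset Printing Implicit Defensive.

Import GRing.Theory.
Local Open Scope ring_scope.

(** * Formal power series, given by their sequence of coefficients *)

Definition fps (R : Type) : Type := nat -> R.

Definition fps_of_poly (R : nzRingType) (p : {poly R}) : fps R := fun k => p`_k.

Definition fps_mul (R : nzRingType) (f g : fps R) : fps R :=
  fun m => \sum_(k < m.+1) f k * g (m - k)%N.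

(* The list of the coefficients 0, ..., m of the inverse of f. *)
Fixpoint fps_inv_seq (R : comUnitRingType) (f : fps R) (m : nat) : seq R :=
  if m is m'.+1 then
    let s := fps_inv_seq f m' in
    rcons s (- (f 0%N)^-1 * \sum_(k < m'.+1) f k.+1 * s`_(m' - k))
  else [:: (f 0%N)^-1].

(* Meaningful only when [f 0] is a unit; see [fps_mulfV]. *)
Definition fps_inv (R : comUnitRingType) (f : fps R) : fps R :=
  fun m => (fps_inv_seq f m)`_m.

Definition fps_div (R : comUnitRingType) (f g : fps R) : fps R :=
  fps_mul f (fps_inv g).

Lemma size_fps_inv_seq (R : comUnitRingType) (f : fps R) m :
  size (fps_inv_seq f m) = m.+1.
Proof. by elim: m => //= m IHm; rewrite size_rcons IHm. Qed.

Lemma nth_fps_inv_seq (R : comUnitRingType) (f : fps R) m k :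
  (k <= m)%N -> (fps_inv_seq f m)`_k = fps_inv f k.
Proof.
elim: m => [|m IHm]; first by rewrite leqn0 => /eqP->.
rewrite leq_eqVlt => /predU1P[-> //|lt_km].
by rewrite /= nth_rcons size_fps_inv_seq lt_km IHm.
Qed.

Lemma fps_mulfV (R : comUnitRingType) (f : fps R) :
  f 0%N \is a GRing.unit -> fps_mul f (fps_inv f) =1 fun m => (m == 0%N)%:R.
Proof.
move=> Uf [|m]; rewrite /fps_mul big_ord_recl subn0.
  by rewrite big_ord0 addr0 divrr.
rewrite {1}/fps_inv /= nth_rcons size_fps_inv_seq ltnn eqxx mulrA mulrN.
rewrite divrr // mulN1r; apply/eqP; rewrite addrC subr_eq0; apply/eqP.
by apply: eq_bigr => k _; rewrite nth_fps_inv_seq ?leq_subr.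
Qed.

(** * q-analogues *)

Definition qint (R : nzRingType) (q : R) (m : nat) : R := \sum_(k < m) q ^+ k.

Definition qpoch (R : comNzRingType) (x q : R) (m : nat) : R :=
  \prod_(i < m) (1 - x * q ^+ i).

(** * Colored permutations *)

(* Positions, values and colors are stored as ordinals; [cp_val] and [cp_col]
   give access to them with positions and values counted from 1. *)
Definition cperm (n r : nat) : finType := ('S_n * {ffun 'I_n -> 'I_r})%type.

(* Meaningful for 1 <= i <= n.+1, with the conventions that the value at
   position n.+1 is n.+1 and its color is 0. *)
Definition cp_val n r (w : cperm n r) (i : nat) : nat :=
  if insub i.-1 is Some j then (w.1 (j : 'I_n)).+1 else n.+1.

Definition cp_col n r (w : cperm n r) (i : nat) : nat :=
  if insub i.-1 is Some j then w.2 (j : 'I_n) : nat else 0%N.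

Definition is_descent n r (w : cperm n r) (i : nat) : bool :=
  (cp_col w i > cp_col w i.+1)%N
  || (cp_col w i == cp_col w i.+1) && (cp_val w i > cp_val w i.+1)%N.

Definition des n r (w : cperm n r) : nat :=
  (\sum_(1 <= i < n.+1 | is_descent w i) 1)%N.

Definition maj n r (w : cperm n r) : nat :=
  (\sum_(1 <= i < n.+1 | is_descent w i) i)%N.

(* The truncated subtraction is exact by [sum_col_le]. *)
Definition fmaj n r (w : cperm n r) : nat :=
  (r * maj w - \sum_(1 <= i < n.+1) cp_col w i)%N.

Lemma cp_col_le n r (w : cperm n r) i : (cp_col w i <= r)%N.
Proof. by rewrite /cp_col; case: insub => // j; apply: ltnW. Qed.

Lemma sum_col_le n r (w : cperm n r) :
  (\sum_(1 <= i < n.+1) cp_col w i <= r * maj w)%N.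
Proof.
suff H m : (\sum_(1 <= i < m.+1) cp_col w i <=
   r * (\sum_(1 <= i < m.+1 | is_descent w i) i) + m * cp_col w m.+1)%N.
  have col_last : cp_col w n.+1 = 0%N by rewrite /cp_col insubN //= ltnn.
  by have := H n; rewrite col_last muln0 addn0.
elim: m => [|m IHm]; first by rewrite big_geq.
rewrite big_nat_recr //= [X in (_ <= r * X + _)%N]big_mkcond /=.
rewrite [X in (_ <= r * X + _)%N]big_nat_recr //= -big_mkcond /= mulnDr.
apply: (leq_trans (leq_add IHm (leqnn _))).
rewrite -!addnA leq_add2l -mulSnr.
have [lt_c|le_c] := ltnP (cp_col w m.+2) (cp_col w m.+1).
  by rewrite /is_descent lt_c /= (leq_trans _ (leq_addr _ _)) // mulnC
             leq_mul2r cp_col_le orbT.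
by rewrite (leq_trans _ (leq_addl _ _)) // leq_mul2l le_c orbT.
Qed.

(** * The generating polynomial *)

(* An element of [{poly {poly int}}] is a polynomial in x whose coefficients are
   polynomials in q. *)
Notation q_ := ('X : {poly int}).
Notation x_ := ('X : {poly {poly int}}).

Definition G (n r l c : nat) : {poly {poly int}} :=
  \sum_(w : cperm n r | (cp_val w 1 == l) && (cp_col w 1 == c))
    x_ ^+ des w * (q_ ^+ fmaj w)%:P.

(* Hence (x q^r; q^r)_n is invertible as a power series in x. *)
Lemma qpoch_coef0 n r :
  (qpoch (x_ * (q_ ^+ r)%:P) (q_ ^+ r)%:P n)`_0 = 1.
Proof.
rewrite -horner_coef0 /qpoch horner_prod big1 // => i _.
by rewrite hornerD hornerN hornerC -mulrA hornerM hornerX mul0r subr0.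
Qed.

(* Main.v *)
Require Import Defs.
From mathcomp Require Import all_boot all_order all_algebra all_fingroup.
From mathcomp Require Import zify ring.

Set Implicit Arguments.
Unset Strict Implicit.
Unset Printing Implicit Defensive.

Import GRing.Theory.
Local Open Scope ring_scope.

(** The identity is proved by induction on n, removing the first letter. Write
  a = q^r.

  Deleting the first letter of a colored permutation w of size n+1 and
  standardizing the rest gives a colored permutation w' of size n. The descents
  of w' are those of w moved one position to the left, so that
  des w = d + des w' and maj w = des w + maj w', where d is 1 if w starts with a
  descent and 0 otherwise; hence c + fmaj w = r des w + fmaj w'. As d depends
  only on the first letters of w and w', this reads
    q^c G^{l,c}_{n+1}(x) = sum over (l',c') of (x a)^d G^{l',c'}_n(x a)
  ([G_recurrence]). The denominator satisfies
    (x a; a)_{n+1} = (1 - x a) (x a . a; a)_n,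
  so that the quotients G / (x a; a)_n are determined by the same recurrence,
  with an additional factor 1 / (1 - x a) ([G_eq_mul_qpoch]).

  It remains to see that the announced coefficients satisfy it. The coefficient
  of x^m is the generating function, by sum of entries, of the vectors in N^n
  whose leftmost maximum is the entry l and is equal to r m - c: the entries to
  its left are smaller, those to its right at most as large. Removing that
  entry leaves an arbitrary vector of length n - 1 with l - 1 entries below
  r m - c and the others at most r m - c. Let this vector have its own leftmost
  maximum at position l', with value r m' - c' where 0 <= c' < r. The condition
  is that r m' - c' is smaller than r m - c, or equal to it with l' >= l; in
  other words m' < m, or m' = m and the letter (l',c') makes no descent after
  (l,c). This is precisely what the factors (x a)^d and 1 / (1 - x a) express:
  m is at least m' + d, and otherwise arbitrary. Algebraically, each of these
  classifications is a telescoping sum based on q^k = [k+1] - [k]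
  ([sum_over_values], [sum_quot_coef_colors]), and together they give
  [quot_coef_rec]. *)

(** * Products and quotients of formal power series *)

Lemma eq_fps_mul (R : nzRingType) (f f' g g' : fps R) :
  f =1 f' -> g =1 g' -> fps_mul f g =1 fps_mul f' g'.
Proof. by move=> Ef Eg m; apply: eq_bigr => k _; rewrite Ef Eg. Qed.

Lemma fps_of_polyM (R : nzRingType) (p q : {poly R}) :
  fps_of_poly (p * q) =1 fps_mul (fps_of_poly p) (fps_of_poly q).
Proof. by move=> m; apply: coefM. Qed.

(** Transfers identities between products of power series to the ring of
  polynomials, one coefficient at a time. *)
Lemma fps_mul_trunc (R : nzRingType) (f g : fps R) N m : (m < N)%N ->
  fps_mul f g m = (\poly_(i < N) f i * \poly_(i < N) g i)`_m.
Proof.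
move=> lt_mN; rewrite coefM; apply: eq_bigr => k _.
have le_km: (k <= m)%N by rewrite -ltnS.
by rewrite !coef_poly !ifT // ?(leq_ltn_trans _ lt_mN) ?leq_subr.
Qed.

Lemma fps_mulA (R : nzRingType) (f g h : fps R) :
  fps_mul f (fps_mul g h) =1 fps_mul (fps_mul f g) h.
Proof.
move=> m; pose t f := \poly_(i < m.+1) f i : {poly R}.
have tM f1 f2 k : (k <= m)%N -> fps_mul f1 f2 k = (t f1 * t f2)`_k.
  by move=> le_km; apply: fps_mul_trunc.
transitivity ((t f * (t g * t h))`_m).
  rewrite coefM; apply: eq_bigr => k _.
  by rewrite -tM ?leq_subr // coef_poly ltn_ord.
rewrite mulrA coefM; apply: eq_bigr => k _.
have le_km : (k <= m)%N by rewrite -ltnS.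
by rewrite -tM // coef_poly ltnS leq_subr.
Qed.

Lemma fps_mul_suml (R : nzRingType) (I : finType) (f : I -> fps R) g m :
  \sum_i fps_mul (f i) g m = fps_mul (fun k => \sum_i f i k) g m.
Proof. by rewrite exchange_big; apply: eq_bigr => k _; rewrite mulr_suml. Qed.

Lemma fps_mulZl (R : nzRingType) (a : R) (f g : fps R) m :
  a * fps_mul f g m = fps_mul (fun k => a * f k) g m.
Proof. by rewrite /fps_mul mulr_sumr; apply: eq_bigr => k _; rewrite mulrA. Qed.

(** Turns the division into a multiplication: all the later work is about
  products, and the inverse series is never computed. *)
Lemma fps_div_unique (R : comUnitRingType) (f g h : fps R) :
  g 0%N \is a GRing.unit -> f =1 fps_mul h g -> fps_div f g =1 h.
Proof.
move=> Ug Ef m.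
rewrite /fps_div (eq_fps_mul Ef (frefl _)) -fps_mulA.
rewrite (eq_fps_mul (frefl h) (fps_mulfV Ug)) /fps_mul.
rewrite big_ord_recr /= subnn mulr1 big1 ?add0r // => k _.
by rewrite subn_eq0 leqNgt ltn_ord mulr0.
Qed.

(** The substitution of a x for x. *)
Definition fps_scale (R : nzRingType) (a : R) (f : fps R) : fps R :=
  fun m => a ^+ m * f m.

Lemma fps_scaleM (R : comNzRingType) (a : R) (f g : fps R) :
  fps_scale a (fps_mul f g) =1 fps_mul (fps_scale a f) (fps_scale a g).
Proof.
move=> m; rewrite /fps_scale /fps_mul mulr_sumr; apply: eq_bigr => k _.
have le_km: (k <= m)%N by rewrite -ltnS.
by rewrite mulrACA -exprD subnKC.
Qed.

Lemma fps_of_poly_comp (R : comNzRingType) (a : R) (p : {poly R}) :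
  fps_of_poly (p \Po ('X * a%:P)) =1 fps_scale a (fps_of_poly p).
Proof.
move=> m; rewrite /fps_of_poly /fps_scale comp_polyE coef_sum.
under eq_bigr => i _ do
  rewrite coefZ exprMn -rmorphXn coefMC coefXn.
have [lt_m|le_m] := ltnP m (size p); last first.
  rewrite [p`_m]nth_default // mulr0 big1 // => i _.
  by rewrite gtn_eqF ?mul0r ?mulr0 // (leq_trans (ltn_ord i)).
rewrite (bigD1 (Ordinal lt_m)) //= eqxx mul1r mulrC big1 ?addr0 // => i.
by rewrite -val_eqE /= eq_sym => /negPf->; rewrite mul0r mulr0.
Qed.

Lemma coef_mul_monomial (R : comNzRingType) (a : R) (d : bool) (f : fps R) m :
  fps_mul (fps_of_poly (('X * a%:P) ^+ d)) f m =
  if d then (if m is m'.+1 then a * f m' else 0) else f m.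
Proof.
rewrite /fps_mul /fps_of_poly; case: d; rewrite ?expr1 ?expr0 => /=.
  case: m => [|m]; first by rewrite big_ord1 coefMC coefX mul0r mul0r.
  rewrite !big_ord_recl !coefMC !coefX !mul0r add0r mul1r subSS subn0.
  by rewrite big1 ?addr0 // => i _; rewrite coefMC coefX !mul0r.
rewrite big_ord_recl coef1 mul1r subn0 big1 ?addr0 // => i _.
by rewrite coef1 mul0r.
Qed.

Lemma coef_mul_1subX (R : comNzRingType) (a : R) (f : fps R) m :
  fps_mul f (fps_of_poly (1 - 'X * a%:P)) m =
  f m - (if m is m'.+1 then a * f m' else 0).
Proof.
rewrite /fps_mul /fps_of_poly big_ord_recr /= subnn coefB coef1 coefMC coefX.
rewrite mul0r subr0 mulr1 addrC; congr (_ + _).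
case: m => [|m]; first by rewrite big_ord0 oppr0.
rewrite big_ord_recr /= subSnn coefB coef1 coefMC coefX mul1r sub0r.
rewrite mulrN [f m * _]mulrC big1 ?add0r // => i _.
rewrite coefB coef1 coefMC coefX subSn 1?ltnW // eqSS subn_eq0 leqNgt ltn_ord.
by rewrite mul0r subr0 mulr0.
Qed.

(** * Removing the first letter of a colored permutation *)

Definition cp_cons n r (h : 'I_n.+1) (c : 'I_r) (w : cperm n r) :
    cperm n.+1 r :=
  (lift_perm ord0 h w.1,
   [ffun i => if unlift ord0 i is Some j then w.2 j else c]).

(** A permutation with a prescribed value at i amounts to a permutation of the
  other positions, after the values other than j have been renumbered. *)
Lemma lift_perm_bij n (i j : 'I_n.+1) :
  {on [pred s : 'S_n.+1 | s i == j], bijective (lift_perm i j)}.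
Proof.
pose drop (s : 'S_n.+1) k := odflt k (unlift (s i) (s (lift i k))).
have dropK (s : 'S_n.+1) k : lift (s i) (drop s k) = s (lift i k).
  rewrite /drop; have := neq_lift i k.
  by rewrite -(inj_eq (@perm_inj _ s)) => /unlift_some[] ? ? ->.
have drop_inj (s : 'S_n.+1) : injective (drop s).
  by move=> k1 k2 /(congr1 (lift (s i))); rewrite !dropK => /perm_inj/lift_inj.
exists (fun s => perm (@drop_inj s)) => [s _ | s /eqP s_i].
  by apply/permP => k; rewrite permE /drop lift_perm_lift lift_perm_id liftK.
apply/permP => k; case: (unliftP i k) => [k'|] ->; last by rewrite lift_perm_id.
by rewrite lift_perm_lift permE -s_i dropK.
Qed.

Lemma cp_val_ord n r (w : cperm n r) (i : 'I_n) : cp_val w i.+1 = (w.1 i).+1.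
Proof. by rewrite /cp_val valK. Qed.

Lemma cp_col_ord n r (w : cperm n r) (i : 'I_n) : cp_col w i.+1 = w.2 i.
Proof. by rewrite /cp_col valK. Qed.

Lemma cp_val_default n r (w : cperm n r) i : (n <= i)%N -> cp_val w i.+1 = n.+1.
Proof. by move=> le_ni; rewrite /cp_val insubN // -leqNgt. Qed.

Lemma cp_col_default n r (w : cperm n r) i : (n <= i)%N -> cp_col w i.+1 = 0%N.
Proof. by move=> le_ni; rewrite /cp_col insubN // -leqNgt. Qed.

Lemma cp_cons_bij n r (h : 'I_n.+1) (c : 'I_r) :
  {on [pred w : cperm n.+1 r | (cp_val w 1 == h.+1) && (cp_col w 1 == c)],
    bijective (cp_cons h c)}.
Proof.
have [tl tlK Ktl] := lift_perm_bij ord0 h.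
exists (fun w : cperm n.+1 r =>
  ((tl w.1, [ffun i : 'I_n => w.2 (lift ord0 i)]) : cperm n r))
  => [[s xi] _ | [s xi]].
  rewrite /= tlK ?inE ?lift_perm_id //; congr (_, _).
  by apply/ffunP => i; rewrite !ffunE liftK.
rewrite inE (cp_val_ord _ ord0) (cp_col_ord _ ord0) /= eqSS.
case/andP => /eqP/val_inj s0 /eqP/val_inj xi0.
rewrite /cp_cons /= Ktl ?inE ?s0 //; congr (_, _); apply/ffunP => i.
by rewrite ffunE; case: unliftP => [j|] -> //; rewrite ffunE.
Qed.

Lemma cp_col_cons0 n r (h : 'I_n.+1) (c : 'I_r) (w : cperm n r) :
  cp_col (cp_cons h c w) 1 = c.
Proof. by rewrite (cp_col_ord _ ord0) ffunE unlift_none. Qed.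

Lemma cp_val_cons0 n r (h : 'I_n.+1) (c : 'I_r) (w : cperm n r) :
  cp_val (cp_cons h c w) 1 = h.+1.
Proof. by rewrite (cp_val_ord _ ord0) lift_perm_id. Qed.

Lemma cp_col_consS n r (h : 'I_n.+1) (c : 'I_r) (w : cperm n r) i :
  cp_col (cp_cons h c w) i.+2 = cp_col w i.+1.
Proof.
have [lt_in|le_ni] := ltnP i n; last by rewrite !cp_col_default.
have := cp_col_ord (cp_cons h c w) (lift ord0 (Ordinal lt_in)).
by rewrite ffunE liftK lift0 /= => ->; rewrite -cp_col_ord.
Qed.

Lemma cp_val_consS n r (h : 'I_n.+1) (c : 'I_r) (w : cperm n r) i :
  cp_val (cp_cons h c w) i.+2 = (bump h (cp_val w i.+1).-1).+1.
Proof.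
have [lt_in|le_ni] := ltnP i n; last first.
  by rewrite !cp_val_default //= /bump -ltnS ltn_ord.
have := cp_val_ord (cp_cons h c w) (lift ord0 (Ordinal lt_in)).
by rewrite lift_perm_lift lift0 /= => ->; rewrite (cp_val_ord w (Ordinal lt_in)).
Qed.

Lemma cp_val_gt0 n r (w : cperm n r) i : (0 < cp_val w i)%N.
Proof. by rewrite /cp_val; case: insub. Qed.

(** Inserting a letter renumbers the values increasingly, with the conventional
  last value n+1 becoming n+2, so comparisons are
  preserved at every position. *)
Lemma is_descent_consS n r (h : 'I_n.+1) (c : 'I_r) (w : cperm n r) i :
  is_descent (cp_cons h c w) i.+2 = is_descent w i.+1.
Proof.
rewrite /is_descent !cp_col_consS !cp_val_consS ltnS.
congr (_ || _ && _); rewrite !ltnNge leq_bump2; congr (~~ _).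
by have := cp_val_gt0 w i.+1; have := cp_val_gt0 w i.+2; lia.
Qed.

(** The order on colored letters that defines descents: first by color, then by
  value. *)
Definition letter_gt (l c l' c' : nat) : bool :=
  (c' < c)%N || (c' == c) && (l' < l)%N.

(** The value following the inserted h+1 is v or v+1, according to whether
  v <= h or not; in both cases it is below h+1 exactly when v is. *)
Lemma is_descent_cons0 n r (h : 'I_n.+1) (c : 'I_r) (w : cperm n r) :
  is_descent (cp_cons h c w) 1 = letter_gt h.+1 c (cp_val w 1) (cp_col w 1).
Proof.
rewrite /is_descent /letter_gt cp_col_consS cp_val_consS.
rewrite cp_col_cons0 cp_val_cons0.
rewrite [c == _ :> nat]eq_sym ltnS; congr (_ || _ && _).
have := cp_val_gt0 w 1; rewrite /bump; lia.
Qed.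

Lemma des_cons n r (h : 'I_n.+1) (c : 'I_r) (w : cperm n r) :
  des (cp_cons h c w) =
  (letter_gt h.+1 c (cp_val w 1) (cp_col w 1) + des w)%N.
Proof.
rewrite /des big_mkcond big_nat_recl //= is_descent_cons0; congr (_ + _)%N.
rewrite [RHS]big_mkcond; apply: eq_big_nat => -[//|i] _.
by rewrite is_descent_consS.
Qed.

(** Each descent inherited from w moves one position to the right and so adds 1
  to maj; a descent at position 1 also adds 1. *)
Lemma maj_cons n r (h : 'I_n.+1) (c : 'I_r) (w : cperm n r) :
  maj (cp_cons h c w) = (des (cp_cons h c w) + maj w)%N.
Proof.
rewrite des_cons /maj /des big_mkcond big_nat_recl //= is_descent_cons0 -addnA.
congr (_ + _)%N.
rewrite [X in (X + _)%N]big_mkcond [X in (_ + X)%N]big_mkcond -big_split.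
apply: eq_big_nat => -[//|i] _ /=.
by rewrite is_descent_consS; case: (is_descent _ _).
Qed.

(** The color c is kept on the left, where natural numbers need no subtraction:
  [sum_col_le] makes the subtractions that define [fmaj] exact. *)
Lemma fmaj_cons n r (h : 'I_n.+1) (c : 'I_r) (w : cperm n r) :
  (c + fmaj (cp_cons h c w) = r * des (cp_cons h c w) + fmaj w)%N.
Proof.
have := sum_col_le (cp_cons h c w); have := sum_col_le w.
rewrite /fmaj maj_cons mulnDr.
rewrite [\sum_(1 <= i < n.+2) _]big_nat_recl //= cp_col_cons0.
have -> : (\sum_(1 <= i < n.+1) cp_col (cp_cons h c w) i.+1 =
           \sum_(1 <= i < n.+1) cp_col w i)%N.
  by apply: eq_big_nat => -[//|i] _; apply: cp_col_consS.
set s := (\sum_(_ <= _ < _) _)%N; lia.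
Qed.

(** Since r des w is added to fmaj w, every factor x coming from a descent is
  accompanied by q^r: this is the substitution of x q^r for x. *)
Lemma G_cons n r (h : 'I_n.+1) (c : 'I_r) :
  (q_ ^+ c)%:P * G n.+1 r h.+1 c =
  \sum_(w : cperm n r)
    (x_ * (q_ ^+ r)%:P) ^+ letter_gt h.+1 c (cp_val w 1) (cp_col w 1)
    * ((x_ ^+ des w * (q_ ^+ fmaj w)%:P) \Po (x_ * (q_ ^+ r)%:P)).
Proof.
rewrite /G (reindex _ (cp_cons_bij h c)) mulr_sumr.
under eq_bigl => w do rewrite cp_val_cons0 cp_col_cons0 !eqxx.
apply: eq_bigr => w _; rewrite mulrCA -polyCM -exprD fmaj_cons.
rewrite comp_polyM comp_polyC comp_Xn_poly mulrA -exprD -des_cons.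
by rewrite exprMn -mulrA -polyC_exp -exprM -polyCM -exprD.
Qed.

Lemma sum_by_first_letter n r (V : nmodType)
    (F : nat -> nat -> cperm n.+1 r -> V) :
  \sum_w F (cp_val w 1).-1 (cp_col w 1) w =
  \sum_(j < n.+1) \sum_(c < r)
    \sum_(w | (cp_val w 1 == j.+1) && (cp_col w 1 == c)) F j c w.
Proof.
pose letter (w : cperm n.+1 r) := (w.1 ord0, w.2 ord0).
rewrite pair_big /= (partition_big letter xpredT) //=.
apply: eq_bigr => -[j c] _; apply: eq_big => [w|w].
  by rewrite (cp_val_ord _ ord0) (cp_col_ord _ ord0) eqSS.
by case/eqP => <- <-; rewrite (cp_val_ord _ ord0) (cp_col_ord _ ord0).
Qed.

(** For at least two letters, the factor attached to the initial descent depends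
  only on the first letter of the shorter permutation, so the sum can be grouped
  by that letter. Here h and j are values counted from 0 and j is a value of the
  standardized permutation, whence the comparison of j with h itself. *)
Lemma G_recurrence n r h c : (h <= n.+1)%N -> (c < r)%N ->
  (q_ ^+ c)%:P * G n.+2 r h.+1 c =
  \sum_(j < n.+1) \sum_(c' < r) (x_ * (q_ ^+ r)%:P) ^+ letter_gt h c j c'
    * (G n.+1 r j.+1 c' \Po (x_ * (q_ ^+ r)%:P)).
Proof.
move=> le_hn lt_cr.
have := G_cons (Ordinal (le_hn : h < n.+2)%N) (Ordinal lt_cr); rewrite /= => ->.
under [RHS]eq_bigr => j _ do under eq_bigr => c' _ do
  rewrite /G (raddf_sum (comp_poly _)) mulr_sumr.
rewrite -(sum_by_first_letter (fun j c' w =>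
   (x_ * (q_ ^+ r)%:P) ^+ letter_gt h c j c'
   * ((x_ ^+ des w * (q_ ^+ fmaj w)%:P) \Po (x_ * (q_ ^+ r)%:P)))).
apply: eq_bigr => w _.
by rewrite /letter_gt -{1}(prednK (cp_val_gt0 w 1)) ltnS.
Qed.

(** The shorter permutation is empty: the letter is followed by the conventional
  last letter, of value 1 and color 0. *)
Lemma G_one_letter r c : (c < r)%N ->
  (q_ ^+ c)%:P * G 1 r 1 c = (x_ * (q_ ^+ r)%:P) ^+ (0 < c)%N.
Proof.
move=> lt_cr; have := G_cons (ord0 : 'I_1) (Ordinal lt_cr); rewrite /= => ->.
rewrite (big_pred1 (1%g, ffun0 (card_ord 0))) => [|[s xi]]; last first.
  rewrite /= xpair_eqE; apply/esym/andP.
  by split; apply/eqP; [apply/permP | apply/ffunP]; case.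
rewrite /des /maj /fmaj /maj !big_geq // muln0 subn0 expr0 mulr1 comp_polyC mulr1.
by rewrite cp_val_default // cp_col_default // /letter_gt ltnn andbF orbF.
Qed.

(** * The recurrence for the coefficients of the quotient *)

(** For h < n, the generating function of the vectors in N^n whose leftmost
  maximum has index h, counted from 0, and value r m - c. For m = 0 the value is
  0, so it is only attained by the zero vector, for which h = c = 0. *)
Definition quot_coef (R : comNzRingType) (q : R) (n r h c m : nat) : R :=
  if m == 0%N then (h == 0%N)%:R * (c == 0%N)%:R
  else qint q (r * m - c) ^+ h * qint q (r * m - c).+1 ^+ (n - h.+1)
       * q ^+ (r * m - c).

Lemma qintS (R : comNzRingType) (q : R) m : qint q m.+1 = qint q m + q ^+ m.
Proof. by rewrite /qint big_ord_recr. Qed.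

(** Counts in two ways the vectors of length n with maximum a, leftmost at index
  h or later: the first h entries are below a, the others are at most a, and not
  all are below a. *)
Lemma sum_over_values (R : comNzRingType) (q : R) n h a : (h <= n)%N ->
  \sum_(h <= j < n) qint q a ^+ j * qint q a.+1 ^+ (n - j.+1) * q ^+ a =
  qint q a ^+ h * qint q a.+1 ^+ (n - h) - qint q a ^+ n.
Proof.
move=> le_hn; pose v j := - (qint q a ^+ j * qint q a.+1 ^+ (n - j)).
rewrite (telescope_sumr_eq v) // => [|j /andP[_ lt_jn]].
  by rewrite /v subnn mulr1 opprK addrC.
rewrite /v -(subnSK lt_jn) !exprS qintS; ring.
Qed.

Lemma sum_quot_coef (R : comNzRingType) (q : R) n r h c m :
  (h <= n)%N -> (0 < m)%N ->
  \sum_(h <= j < n) quot_coef q n r j c m =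
  qint q (r * m - c) ^+ h * qint q (r * m - c).+1 ^+ (n - h)
  - qint q (r * m - c) ^+ n.
Proof.
move=> le_hn; rewrite /quot_coef lt0n => /negPf->.
exact: sum_over_values.
Qed.

(** The generating function of the vectors of length n with entries at most
  r (m - 1), which is what the coefficients of index less than m add up to. *)
Definition box_coef (R : comNzRingType) (q : R) n r m : R :=
  if m is m'.+1 then qint q (r * m').+1 ^+ n else 0.

(** Vectors sorted by their maximum: as c' runs from c to r - 1, the value
  r (m + 1) - c' runs down from r (m + 1) - c to r m + 1, so what is counted is
  the vectors with maximum in this interval. *)
Lemma sum_quot_coef_colors (R : comNzRingType) (q : R) n r c m : (c <= r)%N ->
  \sum_(c <= c' < r) \sum_(j < n) quot_coef q n r j c' m.+1 =
  qint q (r * m.+1 - c).+1 ^+ n - box_coef q n r m.+1.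
Proof.
move=> le_cr; pose u c' := - qint q (r * m.+1 - c').+1 ^+ n.
rewrite (telescope_sumr_eq u) // => [|c' /andP[_ lt_c'r]].
  by rewrite /u opprK addrC mulnS addKn.
rewrite -(big_mkord xpredT (fun j => quot_coef q n r j c' m.+1)).
rewrite sum_quot_coef //.
by rewrite /u opprK subn0 mul1r addrC -subnSK // mulnS; lia.
Qed.

Lemma sum_quot_coef_all (R : comNzRingType) (q : R) n r m :
  (0 < n)%N -> (0 < r)%N ->
  \sum_(j < n) \sum_(c' < r) quot_coef q n r j c' m =
  box_coef q n r m.+1 - box_coef q n r m.
Proof.
move=> n_gt0 r_gt0; rewrite exchange_big /=; case: m => [|m].
  (* The box is reduced to the zero vector, which has h = c = 0. *)
  rewrite /box_coef muln0 subr0 /qint big_ord1 expr0 expr1n.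
  rewrite (bigD1 (Ordinal r_gt0)) //= (bigD1 (Ordinal n_gt0)) //= !big1 => [|i|j].
  - by rewrite /quot_coef /= !mulr1 !addr0.
  - rewrite -val_eqE /= => /negPf i0; apply: big1 => j _.
    by rewrite /quot_coef /= i0 mulr0.
  by rewrite -val_eqE /= => /negPf j0; rewrite /quot_coef /= j0 mul0r.
rewrite -(big_mkord xpredT (fun c' => \sum_(j < n) quot_coef q n r j c' m.+1)).
by rewrite sum_quot_coef_colors // subn0.
Qed.

(** What remains of the vectors counted by [quot_coef] for length n + 1 when
  their leftmost maximum, at index h, is removed; see [quot_coef_tail]. *)
Definition tail_coef (R : comNzRingType) (q : R) n r h c m : R :=
  if m == 0%N then (h == 0%N)%:R * (c == 0%N)%:R
  else qint q (r * m - c) ^+ h * qint q (r * m - c).+1 ^+ (n - h).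

(** The vectors counted by [tail_coef] whose maximum exceeds r (m - 1): their
  leftmost maximum is r m - c' with c' > c, or with c' = c at index h or later,
  that is, it describes a letter making no descent after the letter h, c. *)
Lemma sum_quot_coef_ascent (R : comNzRingType) (q : R) n r h c m :
  (0 < n)%N -> (h <= n)%N -> (c < r)%N ->
  \sum_(j < n) \sum_(c' < r | ~~ letter_gt h c j c') quot_coef q n r j c' m =
  tail_coef q n r h c m - box_coef q n r m.
Proof.
move=> n_gt0 le_hn lt_cr; have r_gt0 : (0 < r)%N by apply: leq_ltn_trans lt_cr.
rewrite (exchange_big_dep xpredT) //=; case: m => [|m].
  rewrite /tail_coef /= subr0.
  rewrite (bigD1 (Ordinal r_gt0)) //= [X in _ + X]big1 => [|i]; last first.
    rewrite -val_eqE /= => /negPf i0; apply: big1 => j _.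
    by rewrite /quot_coef /= i0 mulr0.
  rewrite addr0 big_mkcond (bigD1 (Ordinal n_gt0)) //=.
  rewrite [X in _ + X]big1 => [|i]; last first.
    rewrite -val_eqE /= => /negPf i0.
    by rewrite /quot_coef /= i0 mul0r if_same.
  rewrite addr0 /quot_coef /letter_gt /=.
  by case: c {lt_cr} => [|c]; case: h {le_hn} => [|h] /=; rewrite ?mulr1 ?mulr0.
rewrite -(big_mkord xpredT (fun c' =>
  \sum_(j < n | ~~ letter_gt h c j c') quot_coef q n r j c' m.+1)).
(* Colors below c only give descents, color c gives the values j >= h, and a
   larger color gives all values. *)
rewrite (big_cat_nat _ (ltnW lt_cr)) //= [X in X + _]big_nat_cond.
rewrite big1 ?add0r; last first.
  move=> c' /andP[/andP[_ lt_c'c] _]; apply: big_pred0 => j.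
  by rewrite /letter_gt lt_c'c.
rewrite big_ltn //.
have -> : \sum_(j < n | ~~ letter_gt h c j c) quot_coef q n r j c m.+1 =
          \sum_(h <= j < n) quot_coef q n r j c m.+1.
  rewrite (big_nat_widenl _ 0) // big_mkord; apply: eq_bigl => j.
  by rewrite /letter_gt ltnn eqxx /= -leqNgt.
rewrite sum_quot_coef //.
rewrite (eq_big_nat _ _ (F2 := fun c' =>
  \sum_(j < n) quot_coef q n r j c' m.+1)).
  rewrite sum_quot_coef_colors // /tail_coef /= addrA subnSK ?subrK //.
  by rewrite mulnS; lia.
move=> c' /andP[lt_cc' _]; apply: eq_bigl => j.
by rewrite /letter_gt ltnNge ltnW // gtn_eqF.
Qed.

(** The complement of [sum_quot_coef_ascent] in [sum_quot_coef_all]. *)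
Lemma sum_quot_coef_descent (R : comNzRingType) (q : R) n r h c m :
  (0 < n)%N -> (h <= n)%N -> (c < r)%N ->
  \sum_(j < n) \sum_(c' < r | letter_gt h c j c') quot_coef q n r j c' m =
  box_coef q n r m.+1 - tail_coef q n r h c m.
Proof.
move=> n_gt0 le_hn lt_cr; have r_gt0 : (0 < r)%N by apply: leq_ltn_trans lt_cr.
apply: (addIr (tail_coef q n r h c m - box_coef q n r m)).
rewrite -{1}(sum_quot_coef_ascent q m n_gt0 le_hn lt_cr) -big_split /=.
rewrite addrA subrK -sum_quot_coef_all //.
apply: eq_bigr => j _.
by rewrite [RHS](bigID (fun c' : 'I_r => letter_gt h c j c')).
Qed.

(** A descent raises the degree in x by 1, hence the shift of m. The sum of the
  ascents at m is the tail at m minus a box, and that of the descents at m - 1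
  is the same box minus the tail at m - 1. *)
Lemma quot_coef_rec (R : comNzRingType) (q : R) n r h c m :
  (0 < n)%N -> (h <= n)%N -> (c < r)%N ->
  \sum_(j < n) \sum_(c' < r)
    (if letter_gt h c j c'
     then if m is m'.+1 then quot_coef q n r j c' m' else 0
     else quot_coef q n r j c' m) =
  tail_coef q n r h c m - (if m is m'.+1 then tail_coef q n r h c m' else 0).
Proof.
move=> n_gt0 le_hn lt_cr.
under eq_bigr => j _ do
  (rewrite (bigID (fun c' : 'I_r => letter_gt h c j c')) /=).
rewrite big_split /=.
under [X in X + _]eq_bigr => j _ do under eq_bigr => c' -> do [].
under [X in _ + X]eq_bigr => j _ do under eq_bigr => c' /negPf-> do [].
rewrite sum_quot_coef_ascent //; case: m => [|m].
  by rewrite big1 => [|j _]; rewrite ?big1 // add0r.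
rewrite sum_quot_coef_descent //; ring.
Qed.

(** The removed maximum r m - c contributes q^(r m - c), which the factor q^c
  turns into a power of q^r. *)
Lemma quot_coef_tail (R : comNzRingType) (q : R) n r h c m : (c <= r)%N ->
  q ^+ c * quot_coef q n.+1 r h c m = (q ^+ r) ^+ m * tail_coef q n r h c m.
Proof.
move=> le_cr; rewrite /quot_coef /tail_coef; case: m => [|m] /=.
  rewrite expr0 mul1r; case: c {le_cr} => [|c]; first by rewrite expr0 mul1r.
  by rewrite !mulr0.
rewrite mulrCA -exprD -exprM subnKC; first exact: mulrC.
by rewrite mulnS (leq_trans le_cr) ?leq_addr.
Qed.

Lemma quot_coef_mul_1subX (R : comNzRingType) (q : R) n r h c m : (c <= r)%N ->
  fps_mul (fun k => q ^+ c * quot_coef q n.+1 r h c k)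
          (fps_of_poly (1 - 'X * (q ^+ r)%:P)) m =
  (q ^+ r) ^+ m *
  (tail_coef q n r h c m - (if m is m'.+1 then tail_coef q n r h c m' else 0)).
Proof.
move=> le_cr; rewrite coef_mul_1subX mulrBr quot_coef_tail //.
by case: m => [|m]; rewrite ?mulr0 // quot_coef_tail // mulrA -exprS.
Qed.

(** * The generating polynomial as a product *)

Lemma qpochS n r :
  qpoch (x_ * (q_ ^+ r)%:P) (q_ ^+ r)%:P n.+1 =
  (1 - x_ * (q_ ^+ r)%:P)
  * (qpoch (x_ * (q_ ^+ r)%:P) (q_ ^+ r)%:P n \Po (x_ * (q_ ^+ r)%:P)).
Proof.
rewrite /qpoch big_ord_recl expr0 mulr1 rmorph_prod; congr (_ * _).
apply: eq_bigr => i _; rewrite rmorphB rmorph1 /= !comp_polyM comp_polyX.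
by rewrite -!polyC_exp !comp_polyC -!mulrA -!polyCM -!exprS.
Qed.

Lemma coef_monomial (R : comNzRingType) (a : R) (d : bool) m :
  (('X * a%:P) ^+ d)`_m = a ^+ m * (m == d)%:R.
Proof.
rewrite exprMn -polyC_exp coefMC coefXn mulrC.
by have [->|] := eqVneq m d; rewrite // !mulr0.
Qed.

Lemma G_eq_mul_qpoch n r h c : (h <= n)%N -> (c < r)%N ->
  fps_of_poly (G n.+1 r h.+1 c)
  =1 fps_mul (quot_coef q_ n.+1 r h c)
       (fps_of_poly (qpoch (x_ * (q_ ^+ r)%:P) (q_ ^+ r)%:P n.+1)).
Proof.
elim: n h c => [|n IHn] h c le_hn lt_cr m;
  apply: (mulfI (monic_neq0 (monicXn _ c))).
  (* The tail is empty: only the coefficient at m = (0 < c) survives. *)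
  move: le_hn; rewrite leqn0 => /eqP->.
  rewrite [LHS](_ : _ = ((q_ ^+ c)%:P * G 1 r 1 c)`_m);
    last by rewrite coefCM.
  rewrite (G_one_letter lt_cr) coef_monomial fps_mulZl qpochS {1}/qpoch.
  rewrite big_ord0 rmorph1 mulr1 (quot_coef_mul_1subX _ _ _ _ (ltnW lt_cr)).
  congr (_ * _); rewrite /tail_coef; case: m => [|[|m]] /=.
  - by rewrite subr0 mul1r; case: c {lt_cr}.
  - by rewrite !mulr1 mul1r; case: c {lt_cr} => [|c]; rewrite /= ?subrr ?subr0.
  by rewrite mulr1 subrr; case: c {lt_cr}.
rewrite [LHS](_ : _ = ((q_ ^+ c)%:P * G n.+2 r h.+1 c)`_m);
    last by rewrite coefCM.
rewrite (G_recurrence le_hn lt_cr) coef_sum.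
set a := q_ ^+ r; pose Q := qpoch (x_ * a%:P) a%:P n.+1.
set f : nat -> nat -> fps {poly int} :=
  fun j c' => fps_mul (fps_of_poly ((x_ * a%:P) ^+ letter_gt h c j c'))
                      (fps_scale a (quot_coef q_ n.+1 r j c')).
(* Each term of the recurrence is a multiple of the rescaled denominator, by the
   induction hypothesis. *)
have termE (j : 'I_n.+1) (c' : 'I_r) :
    ((x_ * a%:P) ^+ letter_gt h c j c' * (G n.+1 r j.+1 c' \Po (x_ * a%:P)))`_m
    = fps_mul (f j c') (fps_scale a (fps_of_poly Q)) m.
  rewrite -[LHS]/(fps_of_poly _ m) fps_of_polyM -fps_mulA.
  apply: eq_fps_mul => // k; rewrite -fps_scaleM fps_of_poly_comp.
  by congr (_ * _); apply: IHn; rewrite // -ltnS.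
under eq_bigr => j _ do
  (rewrite coef_sum; under eq_bigr => c' _ do rewrite termE;
   rewrite fps_mul_suml).
rewrite fps_mul_suml.
have fE k : \sum_(j < n.+1) \sum_(c' < r) f j c' k =
   fps_mul (fun k => q_ ^+ c * quot_coef q_ n.+2 r h c k)
           (fps_of_poly (1 - x_ * a%:P)) k.
  rewrite (quot_coef_mul_1subX _ _ _ _ (ltnW lt_cr)) -quot_coef_rec // mulr_sumr.
  apply: eq_bigr => j _; rewrite mulr_sumr; apply: eq_bigr => c' _.
  rewrite /f coef_mul_monomial /fps_scale -/a; case: (letter_gt _ _ _ _) => //.
  by case: k => [|k]; rewrite ?mulr0 // mulrA -exprS.
rewrite (eq_fps_mul fE (frefl _)) -fps_mulA fps_mulZl.
apply: eq_fps_mul => // k; rewrite qpochS fps_of_polyM.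
by apply: eq_fps_mul => // i; rewrite fps_of_poly_comp.
Qed.

Theorem theorem4p1 (n r : nat) (n_gt0 : (0 < n)%N) (r_gt0 : (0 < r)%N)
    (l c : nat) (l_bounds : (1 <= l <= n)%N) (c_bound : (c <= r - 1)%N) :
  fps_div (fps_of_poly (G n r l c))
          (fps_of_poly (qpoch (x_ * (q_ ^+ r)%:P) (q_ ^+ r)%:P n))
  =1 (fun i : nat =>
        if i == 0%N then (l == 1%N)%:R * (c == 0%N)%:R
        else qint q_ (r * i - c) ^+ (l - 1)
             * qint q_ (r * i - c + 1) ^+ (n - l)
             * q_ ^+ (r * i - c)).
Proof.
case: n n_gt0 l_bounds => // n _; case: l => // h /= le_hn m.
have lt_cr : (c < r)%N by rewrite -(prednK r_gt0) ltnS -subn1.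
rewrite (fps_div_unique _ (G_eq_mul_qpoch (le_hn : (h <= n)%N) lt_cr)); last first.
  by rewrite /fps_of_poly qpoch_coef0 unitr1.
by rewrite /quot_coef eqSS subn1 addn1.
Qed.
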